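(* For every positive integer $n$, there exists a $P_{3n}$-induced-saturated graph.
   Context: All graphs are finite and simple. $P_k$ denotes the path on $k$ vertices. For a graph $H$, a graph $G$ is $H$-induced-saturated if $G$ does not contain an induced subgraph isomorphic to $H$, but for every edge $e$ of $G$ the graph $G-e$ contains an induced copy of $H$, and for every non-edge $e$ of $G$ (an unordered pair of distinct non-adjacent vertices) the graph $G+e$ contains an induced copy of $H$. *)

(* Defs.v *)
From mathcomp Require Import all_boot.

Set Implicit Arguments.
Unset Strict Implicit.
Unset Printing Implicit Defensive.

Record sgraph := SGraph {
  vertex :> finType;
  adj : rel vertex;
  adj_sym : symmetric adj;
  adj_irr : irreflexive adj }.

Section Operations.
Variable G : sgraph.
Implicit Types (S : {set G}) (x y u v : G).

Definition induced_adj S : rel {x : G | x \in S} :=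
  fun a b => adj (val a) (val b).

Fact induced_adj_sym S : symmetric (@induced_adj S).
Proof. by move=> a b; apply: adj_sym. Qed.

Fact induced_adj_irr S : irreflexive (@induced_adj S).
Proof. by move=> a; apply: adj_irr. Qed.

Definition induced S : sgraph :=
  SGraph (@induced_adj_sym S) (@induced_adj_irr S).

Definition del_adj x y : rel G :=
  fun u v => adj u v && ([set u; v] != [set x; y]).

Fact del_adj_sym x y : symmetric (del_adj x y).
Proof. by move=> u v; rewrite /del_adj adj_sym setUC. Qed.

Fact del_adj_irr x y : irreflexive (del_adj x y).
Proof. by move=> u; rewrite /del_adj adj_irr. Qed.

Definition del_edge x y : sgraph := SGraph (del_adj_sym x y) (del_adj_irr x y).

(* The guard [u != v] keeps the result loopless when x = y, in which case
   nothing is added. *)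
Definition add_adj x y : rel G :=
  fun u v => (u != v) && (adj u v || ([set u; v] == [set x; y])).

Fact add_adj_sym x y : symmetric (add_adj x y).
Proof. by move=> u v; rewrite /add_adj eq_sym adj_sym setUC. Qed.

Fact add_adj_irr x y : irreflexive (add_adj x y).
Proof. by move=> u; rewrite /add_adj eqxx. Qed.

Definition add_edge x y : sgraph := SGraph (add_adj_sym x y) (add_adj_irr x y).

End Operations.

Definition isomorphic (G H : sgraph) : Prop :=
  exists2 f : G -> H, bijective f & forall u v : G, adj (f u) (f v) = adj u v.

Definition contains_induced (G H : sgraph) : Prop :=
  exists S : {set G}, isomorphic (induced S) H.

Section Path.
Variable k : nat.

Definition path_adj : rel 'I_k :=
  fun i j => (i.+1 == j :> nat) || (j.+1 == i :> nat).

Fact path_adj_sym : symmetric path_adj.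
Proof. by move=> i j; rewrite /path_adj orbC. Qed.

Fact path_adj_irr : irreflexive path_adj.
Proof. by move=> i; rewrite /path_adj orbb; apply/negbTE; rewrite gtn_eqF. Qed.

Definition path_graph : sgraph := SGraph path_adj_sym path_adj_irr.

End Path.

(* Graphs on at most one vertex, having neither edges nor non-edges, are
   vacuously H-induced-saturated for every H on at least two vertices;
   existence claims are only meaningful together with [1 < #|G|]. *)
Definition induced_saturated (H G : sgraph) : Prop :=
  [/\ ~ contains_induced G H,
      forall x y : G, adj x y -> contains_induced (del_edge x y) H
    & forall x y : G, x != y -> ~~ adj x y ->
        contains_induced (add_edge x y) H].

(* Main.v *)
Require Import Defs.
From HB Require Import structures.
From mathcomp Require Import all_boot zify.

(** For [n = 1] take a triangle.  For [n > 1] put [m = 3n - 1] and take the complementary prism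
    of the cycle [C_m]: an outer copy [u_i] of the cycle, an inner copy [v_i] of its complement,
    and the spokes [u_i v_i]; for [m = 5] this is the Petersen graph.  It is
    [P_(m+1)]-induced-saturated for every [m >= 5].

    No induced [P_(m+1)]: such a path with [s] inner vertices misses exactly [s - 1] outer ones.
    Its inner part is acyclic, hence has a vertex of degree at most 1 in the complement of the
    cycle, and so [s <= 4], with equality only if three of the inner indices are consecutive.
    In each remaining case the degree bound 2 determines the missing outer vertices, and a cycle
    or a third leaf appears around the inner indices.

    Saturation: after a rotation, and possibly an exchange of its ends, a pair of vertices has
    indices [0] and [j], and an explicit path on [m + 1] vertices appears when its adjacency is
    toggled. *)

Set Implicit Arguments.
Unset Strict Implicit.
Unset Printing Implicit Defensive.

Lemma eq_set2E (T : finType) (u v x y : T) :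
  ([set u; v] == [set x; y]) = (u == x) && (v == y) || (u == y) && (v == x).
Proof.
apply/eqP/idP => [/setP eq_uv|/orP[]/andP[/eqP-> /eqP->]//]; last exact: setUC.
have := (eq_uv u, eq_uv v, eq_uv x, eq_uv y); rewrite !inE !eqxx ?orbT /=.
rewrite [x == u]eq_sym [y == u]eq_sym [x == v]eq_sym [y == v]eq_sym.
by do 4! [case: (_ == _)] => //=; case=> [[[]]].
Qed.

Lemma card_filter_pred1 (T : finType) (A : {set T}) a :
  #|[set y in A | y == a]| = (a \in A).
Proof.
have [Aa|nAa] := boolP (a \in A).
  rewrite (_ : [set y in A | y == a] = [set a]) ?cards1 //.
  by apply/setP => y; rewrite !inE andb_idl // => /eqP->.
apply/eqP; rewrite cards_eq0 -subset0; apply/subsetP => y; rewrite !inE => /andP[Ay /eqP eq_ya].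
by rewrite -eq_ya Ay in nAa.
Qed.

Lemma card_filter_seq (T : finType) (P : pred T) (s : seq T) :
  uniq s -> #|[set y in [set:: s] | P y]| = count P s.
Proof.
move=> uniq_s; rewrite -size_filter -(card_uniqP (filter_uniq P uniq_s)).
by apply: eq_card => y; rewrite !inE mem_filter andbC.
Qed.

Lemma set_seqE (T : finType) (s : seq T) (A : {set T}) :
  uniq s -> {subset s <= A} -> #|A| <= size s -> A = [set:: s].
Proof.
move=> uniq_s sA leA; apply/esym/eqP; rewrite eqEcard cardsE (card_uniqP uniq_s) leA andbT.
by apply/subsetP => x; rewrite inE; apply: sA.
Qed.

Lemma set_seq_rcons (T : finType) (s : seq T) (A : {set T}) :
  uniq s -> {subset s <= A} -> #|A| = (size s).+1 ->
  exists2 x, x \notin s & A = [set:: rcons s x].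
Proof.
move=> uniq_s sA cardA.
have /subsetPn[x Ax] : ~~ (A \subset [set:: s]).
  apply: contraL (leqnn #|A|) => /subset_leq_card.
  by rewrite cardsE (card_uniqP uniq_s) cardA ltnNge.
rewrite inE => s'x; exists x => //; apply: set_seqE.
- by rewrite rcons_uniq s'x.
- by move=> y; rewrite mem_rcons => /predU1P[->|/sA].
- by rewrite size_rcons cardA.
Qed.

(** * Induced embeddings and edge toggling *)

Section Embeddings.
Variables H G : sgraph.

Definition induced_embedding (f : H -> G) : Prop :=
  injective f /\ {mono f : u v / adj u v}.

Lemma isomorphic_inducedP (S : {set G}) :
  isomorphic (induced S) H <-> exists2 f, induced_embedding f & S = f @: setT.
Proof.
split=> [[g [h gK hK] adj_g]|[f [inj_f adj_f] defS]].
  exists (val \o h).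
    split=> [i j /val_inj /(can_inj hK)//|i j].
    by rewrite -[in RHS](hK i) -[in RHS](hK j) adj_g.
  apply/setP => x; apply/idP/imsetP => [Sx|[i _ ->]]; last exact: valP.
  by exists (g (Sub x Sx)); rewrite ?inE //= gK.
have Sf i : f i \in S by rewrite defS imset_f.
pose h i : induced S := Sub (f i) (Sf i).
have inj_h : injective h by move=> i j /(congr1 val) /inj_f.
have [g hK gK] : bijective h.
  by apply: inj_card_bij => //; rewrite card_sig defS card_imset // cardsT.
exists g; first by exists h.
by move=> u v; rewrite -adj_f -[in RHS](gK u) -[in RHS](gK v).
Qed.

Lemma contains_inducedP : contains_induced G H <-> exists f : H -> G, induced_embedding f.
Proof.
split=> [[S /isomorphic_inducedP[f f_emb _]]|[f f_emb]]; first by exists f.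
by exists (f @: setT); apply/isomorphic_inducedP; exists f.
Qed.

End Embeddings.

Lemma eq_adj_contains_induced (T : finType) (e e' : rel T) e_sym e_irr e'_sym e'_irr (H : sgraph) :
  e =2 e' -> contains_induced (@SGraph T e e_sym e_irr) H ->
  contains_induced (@SGraph T e' e'_sym e'_irr) H.
Proof.
move=> eq_e /contains_inducedP[f [inj_f adj_f]]; apply/contains_inducedP.
by exists f; split=> // u v; rewrite -adj_f /= eq_e.
Qed.

Lemma path_induced_embedding (G : sgraph) k (p : path_graph k -> G) :
  (forall i j : 'I_k, i < j -> p i != p j /\ adj (p i) (p j) = (i.+1 == j)) -> induced_embedding p.
Proof.
move=> p_lt; split=> [i j|i j].
  by case: (ltngtP i j) => [/p_lt[/eqP]|/p_lt[/eqP ne _ /esym]|/val_inj].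
rewrite /= /path_adj; case: (ltngtP i j) => [lt_ij|lt_ji|/val_inj->].
- by have [_ ->] := p_lt i j lt_ij; lia.
- by rewrite adj_sym; have [_ ->] := p_lt j i lt_ji; lia.
- by rewrite adj_irr; lia.
Qed.

Section Toggle.
Variable G : sgraph.
Implicit Types x y u v : G.

Definition toggle_adj x y : rel G :=
  fun u v => (u != v) && (adj u v (+) ([set u; v] == [set x; y])).

Fact toggle_adj_sym x y : symmetric (toggle_adj x y).
Proof. by move=> u v; rewrite /toggle_adj eq_sym adj_sym setUC. Qed.

Fact toggle_adj_irr x y : irreflexive (toggle_adj x y).
Proof. by move=> u; rewrite /toggle_adj eqxx. Qed.

Definition toggle_edge x y : sgraph := SGraph (toggle_adj_sym x y) (toggle_adj_irr x y).

Lemma adj_set2 x y u v : [set u; v] = [set x; y] -> adj u v = adj x y.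
Proof.
move/eqP; rewrite eq_set2E => /orP[]/andP[/eqP-> /eqP->] //; exact: adj_sym.
Qed.

Lemma toggle_adj_del x y : adj x y -> toggle_adj x y =2 del_adj x y.
Proof.
move=> adj_xy u v; rewrite /toggle_adj /del_adj.
have [/adj_set2 ->|_] := eqVneq [set u; v]; rewrite ?adj_xy ?andbF // addbF andbT andb_idl //.
by apply: contraTneq => ->; rewrite adj_irr.
Qed.

Lemma toggle_adj_add x y : ~~ adj x y -> toggle_adj x y =2 add_adj x y.
Proof.
move=> /negPf nadj_xy u v; rewrite /toggle_adj /add_adj.
by have [/adj_set2->|_] := eqVneq [set u; v]; rewrite ?nadj_xy ?addbF ?orbF.
Qed.

Lemma toggle_induced_saturated H :
  ~ contains_induced G H ->
  (forall x y, x != y -> contains_induced (toggle_edge x y) H) ->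
  induced_saturated H G.
Proof.
move=> free toggled; split=> // x y => [adj_xy|xy nadj_xy].
  have xy : x != y by apply: contraTneq adj_xy => ->; rewrite adj_irr.
  exact: eq_adj_contains_induced (toggle_adj_del adj_xy) (toggled x y xy).
exact: eq_adj_contains_induced (toggle_adj_add nadj_xy) (toggled x y xy).
Qed.

Lemma contains_toggle_edgeC H x y :
  contains_induced (toggle_edge x y) H -> contains_induced (toggle_edge y x) H.
Proof. by apply: eq_adj_contains_induced => u v; rewrite /toggle_adj [[set x; y]]setUC. Qed.

End Toggle.

(** * Degrees and leaves in induced paths *)

Definition degree (G : sgraph) (A : {set G}) (x : G) : nat := #|[set y in A | adj x y]|.

Definition leaf (G : sgraph) (A : {set G}) : pred G :=
  fun x => (x \in A) && (degree A x <= 1).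

Lemma degree_set_seq (G : sgraph) (s : seq G) x : uniq s -> degree [set:: s] x = count (adj x) s.
Proof. exact: card_filter_seq. Qed.

Lemma degree_imset (H G : sgraph) (f : H -> G) (A : {set H}) i :
  induced_embedding f -> degree (f @: A) (f i) = degree A i.
Proof.
move=> [inj_f adj_f]; rewrite /degree -[in RHS](card_imset _ inj_f); apply: eq_card => y.
rewrite !inE; apply/andP/imsetP => [[/imsetP[j Aj ->]]|[j]].
  by rewrite adj_f; exists j; rewrite ?inE ?Aj.
by rewrite inE => /andP[Aj adj_ij] ->; rewrite imset_f ?adj_f.
Qed.

Lemma degree_path_graph k (i : path_graph k) : degree setT i = (0 < i) + (i.+1 < k).
Proof.
have cardE a : #|[set j : 'I_k | j == a :> nat]| = (a < k).
  by rewrite cardsE -sum1_card (big_ord1_eq _ (fun=> 1)); case: ltnP.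
pose above := [set j : 'I_k | j == i.+1 :> nat].
pose below := [set j : 'I_k | j == (if 0 < i then i.-1 else k) :> nat].
have lt_ik := ltn_ord i; rewrite /degree (_ : finset _ = above :|: below); last first.
  by apply/setP => j; rewrite !inE /= /path_adj; have := ltn_ord j; case: ifP; lia.
rewrite cardsU !cardE (_ : _ :&: _ = set0) ?cards0; first by case: ifP; lia.
by apply/setP => j; rewrite !inE; have := ltn_ord j; case: ifP; lia.
Qed.

Lemma degree_ucycle_gt1 (G : sgraph) (s : seq G) :
  uniq s -> cycle (@adj G) s -> 2 < size s -> {in s, forall x, 1 < degree [set:: s] x}.
Proof.
move=> uniq_s cycle_s size_s x /rot_to[n s' rot_s]; rewrite degree_set_seq //.
move: uniq_s cycle_s size_s; rewrite -(rot_uniq n) -(rot_cycle n) -(size_rot n).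
have /permP-> : perm_eq s (rot n s) by rewrite perm_sym perm_rot.
rewrite {}rot_s; case: s' => // a s'; case/lastP: s' => // s' b _ + _.
rewrite /= !rcons_path last_rcons -cats1 count_cat /=.
by case/and3P=> -> _; rewrite [adj b x]adj_sym => ->; lia.
Qed.

Section InducedPath.
Variables (G : sgraph) (k : nat) (Q : {set G}).
Hypothesis pathQ : isomorphic (induced Q) (path_graph k).

Lemma card_path : #|Q| = k.
Proof.
have [f [inj_f _] ->] := (isomorphic_inducedP _ _).1 pathQ.
by rewrite card_imset // cardsT card_ord.
Qed.

Lemma path_degree_le2 x : x \in Q -> degree Q x <= 2.
Proof.
have [f f_emb ->] := (isomorphic_inducedP _ _).1 pathQ.
by case/imsetP=> i _ ->; rewrite degree_imset // degree_path_graph; lia.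
Qed.

Lemma path_degree_gt0 x : 1 < k -> x \in Q -> 0 < degree Q x.
Proof.
have [f f_emb ->] := (isomorphic_inducedP _ _).1 pathQ.
by move=> k_gt1 /imsetP[i _ ->]; rewrite degree_imset // degree_path_graph; lia.
Qed.

Lemma path_no_third_leaf x y z :
  leaf Q x -> leaf Q y -> leaf Q z -> uniq [:: x; y; z] -> False.
Proof.
have [f f_emb ->] := (isomorphic_inducedP _ _).1 pathQ; have [inj_f _] := f_emb.
have ends u : leaf (f @: setT) u -> exists2 i, u = f i & (i == 0 :> nat) || (i.+1 == k).
  case/andP=> /imsetP[i _ ->]; rewrite degree_imset // degree_path_graph => leaf_i.
  by exists i => //; have := ltn_ord i; lia.
move=> /ends[i -> +] /ends[j -> +] /ends[l -> +].
rewrite /= !inE !(inj_eq inj_f) -!val_eqE /=; lia.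
Qed.

Lemma path_acyclic (A : {set G}) :
  A \subset Q -> A != set0 -> exists x, leaf A x.
Proof.
have [f [inj_f adj_f] ->] := (isomorphic_inducedP _ _).1 pathQ.
move=> /subsetP sAQ /set0Pn[x Ax]; have /imsetP[i0 _ def_x] := sAQ x Ax.
rewrite {x}def_x in Ax; have [i Ai max_i] := @arg_maxnP _ i0 (fun i => f i \in A) val Ax.
exists (f i); rewrite /leaf Ai; apply/card_le1_eqP => a b; rewrite !inE.
case/andP=> /[dup] /sAQ /imsetP[a' _ ->] Aa + /andP[/[dup] /sAQ /imsetP[b' _ ->] Ab].
rewrite !adj_f /= /path_adj => ia ib; congr f; apply: val_inj.
by move: (max_i a' Aa) (max_i b' Ab) ia ib => /=; lia.
Qed.

Lemma path_no_cycle (s : seq G) :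
  uniq s -> cycle (@adj G) s -> 2 < size s -> {subset s <= Q} -> False.
Proof.
move=> uniq_s cycle_s size_s sQ.
have [||x] := path_acyclic (A := [set:: s]).
- by apply/subsetP => x; rewrite inE; apply: sQ.
- by case: (s) size_s => // a s' _; apply/set0Pn; exists a; rewrite !inE eqxx.
by rewrite /leaf inE leqNgt => /andP[/(degree_ucycle_gt1 uniq_s cycle_s size_s)->].
Qed.

End InducedPath.

(** * Complementary prisms *)

(* The first component is [true] on the copy of the graph and [false] on that of its
   complement. *)
Definition prism_adj (T : eqType) (e : rel T) : rel (bool * T) :=
  fun u v => if u.1 != v.1 then u.2 == v.2
             else if u.1 then e u.2 v.2 else (u.2 != v.2) && ~~ e u.2 v.2.

Local Notation U i := (true, i).
Local Notation V i := (false, i).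

Section ComplementaryPrism.
Variable G : sgraph.

Definition complement_adj : rel G := fun i j => (i != j) && ~~ adj i j.

Fact complement_adj_sym : symmetric complement_adj.
Proof. by move=> i j; rewrite /complement_adj eq_sym adj_sym. Qed.

Fact complement_adj_irr : irreflexive complement_adj.
Proof. by move=> i; rewrite /complement_adj eqxx. Qed.

Definition complement : sgraph := SGraph complement_adj_sym complement_adj_irr.

Lemma card_degree_complement (A : {set G}) i :
  i \in A -> #|A| = (degree A i + @degree complement A i).+1.
Proof.
move=> Ai; rewrite (cardsD1 i) Ai -(cardsID [set j | adj i j]); congr (_ + _).+1.
  apply: eq_card => j; rewrite !inE; case: (eqVneq j i) => //= ->.
  by rewrite adj_irr andbF.
by apply: eq_card => j; rewrite !inE /= /complement_adj eq_sym andbC -andbA andbCA.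
Qed.

Fact prism_adj_sym : symmetric (prism_adj (@adj G)).
Proof.
move=> [a i] [b j]; rewrite /prism_adj /= [b == a]eq_sym [j == i]eq_sym adj_sym.
by case: eqVneq => //= ->.
Qed.

Fact prism_adj_irr : irreflexive (prism_adj (@adj G)).
Proof. by move=> [[] i]; rewrite /prism_adj /= ?adj_irr ?eqxx. Qed.

Definition complementary_prism : sgraph := SGraph prism_adj_sym prism_adj_irr.

End ComplementaryPrism.

(* Locked because [inE] would otherwise unfold memberships in these sets. *)
HB.lock Definition outer (G : sgraph) (A : {set complementary_prism G}) : {set G} :=
  [set i | U i \in A].

HB.lock Definition inner (G : sgraph) (A : {set complementary_prism G}) : {set G} :=
  [set i | V i \in A].

Section PrismDegree.
Variable G : sgraph.
Implicit Types (A : {set complementary_prism G}) (i : G).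

Lemma mem_outer A i : (i \in outer A) = (U i \in A). Proof. by rewrite outer.unlock inE. Qed.

Lemma mem_inner A i : (i \in inner A) = (V i \in A). Proof. by rewrite inner.unlock inE. Qed.

Lemma card_outer_inner A : #|A| = #|outer A| + #|inner A|.
Proof.
have injP b : injective (@pair bool G b) by move=> i j [].
rewrite -(cardsID [set u | u.1] A) -(card_imset (outer A) (injP true)).
rewrite -(card_imset (inner A) (injP false)); congr (_ + _).
  apply: eq_card => -[b i]; rewrite !inE andbC /=.
  apply/andP/imsetP => [[]|[j]]; last by rewrite mem_outer => Aj [-> ->].
  by case: b => // _ Ai; exists i; rewrite ?mem_outer.
apply: eq_card => -[b i]; rewrite !inE /=.
apply/andP/imsetP => [[]|[j]]; last by rewrite mem_inner => Aj [-> ->].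
by case: b => // _ Ai; exists i; rewrite ?mem_inner.
Qed.

Lemma degree_outer A i : degree A (U i) = degree (outer A) i + (i \in inner A).
Proof.
rewrite /degree card_outer_inner -card_filter_pred1; congr (_ + _).
  by apply: eq_card => j; rewrite mem_outer !inE mem_outer.
by apply: eq_card => j; rewrite mem_inner !inE mem_inner /= /prism_adj /= eq_sym.
Qed.

Lemma degree_inner A i : degree A (V i) = (i \in outer A) + @degree (complement G) (inner A) i.
Proof.
rewrite /degree card_outer_inner -card_filter_pred1; congr (_ + _).
  by apply: eq_card => j; rewrite mem_outer !inE mem_outer /= /prism_adj /= eq_sym.
by apply: eq_card => j; rewrite mem_inner !inE mem_inner.
Qed.

End PrismDegree.

(** * Cycles *)

(* Exchanging [succ] and [pred] is the reflection of the cycle. *)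
Record cycle_structure (G : sgraph) (succ pred : G -> G) : Prop := CycleStructure {
  succK : cancel succ pred;
  predK : cancel pred succ;
  adj_cycle : forall i j, adj i j = (j == succ i) || (j == pred i);
  succ_connected : forall i j, fconnect succ i j }.

Lemma cycle_structure_rev (G : sgraph) (succ pred : G -> G) :
  cycle_structure succ pred -> cycle_structure pred succ.
Proof.
case=> sK pK adjE conn; split=> // i j; first by rewrite adjE orbC.
rewrite -(eq_fconnect (finv_eq_can sK)) same_fconnect_finv //; exact: can_inj sK.
Qed.

Section CycleStructure.
Variables (G : sgraph) (succ pred : G -> G).
Hypothesis cycG : cycle_structure succ pred.
Implicit Types (i j : G) (A : {set G}).

Lemma succ_inj : injective succ. Proof. exact: can_inj (succK cycG). Qed.

Lemma order_succ i : order succ i = #|G|.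
Proof. by rewrite /order; apply: eq_card => j; rewrite !inE (succ_connected cycG). Qed.

Lemma iter_succ_card i : iter #|G| succ i = i.
Proof. by rewrite -[X in iter X](order_succ i) iter_order //; apply: succ_inj. Qed.

Lemma eq_iter_succ i a b :
  a < #|G| -> b < #|G| -> (iter a succ i == iter b succ i) = (a == b).
Proof.
rewrite -(order_succ i) => lt_a lt_b; apply/eqP/eqP => [|->//].
by move/(congr1 (findex succ i)); rewrite !findex_iter.
Qed.

Lemma iter_succ_subK i a : a <= #|G| -> iter (#|G| - a) succ (iter a succ i) = i.
Proof. by move=> le_a; rewrite -iterD subnK // iter_succ_card. Qed.

Lemma rev_traject_succ n i : rev (traject succ i n.+1) = traject pred (iter n succ i) n.+1.
Proof.
elim: n => // n IHn; rewrite trajectSr rev_rcons {}IHn [in RHS]trajectS.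
by rewrite [in RHS]iterS (succK cycG).
Qed.

Lemma set_traject_pred n i :
  [set:: traject pred (iter n succ i) n.+1] = [set:: traject succ i n.+1].
Proof. by rewrite -rev_traject_succ; apply/setP => j; rewrite !inE mem_rev. Qed.

Lemma succ_eq_pred i j : (succ i == j) = (i == pred j).
Proof. exact: can2_eq (succK cycG) (predK cycG) i j. Qed.

Lemma pred_eq_succ i j : (pred i == j) = (i == succ j).
Proof. exact: can2_eq (predK cycG) (succK cycG) i j. Qed.

Hypothesis card_gt4 : 4 < #|G|.

Lemma cycle_eqE :
  ((forall i, (i == i) = true)
  * ((forall i, (succ i == i) = false) * (forall i, (i == succ i) = false))
  * ((forall i, (succ (succ i) == i) = false) * (forall i, (i == succ (succ i)) = false))
  * ((forall i, (succ (succ (succ i)) == i) = false)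
     * (forall i, (i == succ (succ (succ i))) = false))
  * ((forall i, (succ (succ (succ (succ i))) == i) = false)
     * (forall i, (i == succ (succ (succ (succ i)))) = false))
  * ((forall i, (pred i == i) = false) * (forall i, (i == pred i) = false))
  * ((forall i, (succ i == pred i) = false) * (forall i, (pred i == succ i) = false))
  * ((forall i j, (succ i == succ j) = (i == j)) * (forall i j, (pred i == pred j) = (i == j)))
  * (cancel succ pred * cancel pred succ))%type.
Proof.
have neqL a i : 0 < a < 5 -> (iter a succ i == i) = false.
  by move=> a_bnd; rewrite -[X in _ == X]/(iter 0 succ i) eq_iter_succ; lia.
have neqR a i : 0 < a < 5 -> (i == iter a succ i) = false by rewrite eq_sym; apply: neqL.
(do !split) => [i|i|i|i|i|i|i|i|i|i|i|i|i|i j|i j|i|i]; first exact: eqxx.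
all: rewrite ?(succK cycG) ?(predK cycG) // ?(inj_eq succ_inj) ?(inj_eq (can_inj (predK cycG))) //.
all: rewrite ?pred_eq_succ -?succ_eq_pred.
all: by [exact: (neqL 1) | exact: (neqR 1) | exact: (neqL 2) | exact: (neqR 2)
       | exact: (neqL 3) | exact: (neqR 3) | exact: (neqL 4) | exact: (neqR 4)].
Qed.

Lemma adj_cycle_succ i j : adj i j = (j == succ i) || (i == succ j).
Proof. by rewrite (adj_cycle cycG) [j == pred i]eq_sym pred_eq_succ. Qed.

Lemma degree_succ_pred A i : degree A i = (succ i \in A) + (pred i \in A).
Proof.
rewrite /degree -!card_filter_pred1 -cardsUI (_ : _ :&: _ = set0) ?cards0 ?addn0.
  by apply: eq_card => j; rewrite !inE (adj_cycle cycG) andb_orr.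
apply/setP => j; rewrite !inE; case: (eqVneq j (succ i)) => [->|]; rewrite ?andbF //.
by rewrite cycle_eqE !andbF.
Qed.

End CycleStructure.

(** * The complementary prism of a cycle has no long induced path *)

Section PrismPath.
Variables (G : sgraph) (Q : {set complementary_prism G}).
Hypothesis pathQ : isomorphic (induced Q) (path_graph #|G|.+1).

Local Notation O := (outer Q).
Local Notation I := (inner Q).

Lemma card_inner : #|I| = #|~: O|.+1.
Proof. by have := card_outer_inner Q; have := cardsC O; rewrite (card_path pathQ); lia. Qed.

Lemma outer_eq_notin (s : seq G) :
  uniq s -> all [predC O] s -> #|I| = (size s).+1 -> O = [set i | i \notin s].
Proof.
rewrite card_inner => uniq_s /allP sO [cardO].
suff /(congr1 (@setC G)) : ~: O = [set:: s].
  by rewrite setCK => ->; apply/setP => i; rewrite !inE.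
apply: set_seqE => //; last by rewrite cardO.
by move=> i /sO; rewrite in_setC.
Qed.

Lemma exists_inner_leaf : exists2 i, i \in I & @degree (complement G) I i <= 1.
Proof.
have innerA : inner [set u in Q | ~~ u.1] = I by apply/setP => i; rewrite !mem_inner inE andbT.
have [||[[] i]] := path_acyclic pathQ (A := [set u in Q | ~~ u.1]).
- by apply/subsetP => u; rewrite inE => /andP[].
- have /card_gt0P[i] : 0 < #|I| by rewrite card_inner.
  by rewrite mem_inner => Qi; apply/set0Pn; exists (V i); rewrite inE Qi.
- by rewrite /leaf inE andbF.
rewrite /leaf degree_inner -mem_inner innerA mem_outer inE andbF => /andP[Ii leaf_i].
by exists i.
Qed.

Lemma inner_degree_le2 i : i \in I -> (i \in O) + @degree (complement G) I i <= 2.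
Proof. by rewrite -degree_inner mem_inner; exact: (path_degree_le2 pathQ). Qed.

Lemma inner_degree_gt0 i : i \in I -> 0 < (i \in O) + @degree (complement G) I i.
Proof.
rewrite -degree_inner mem_inner; apply: (path_degree_gt0 pathQ).
by rewrite ltnS; apply/card_gt0P; exists i.
Qed.

Lemma leaf_inner (s : seq G) i : uniq s -> I = [set:: s] -> i \in I ->
  leaf Q (V i) = ((i \in O) + count (@complement_adj G i) s <= 1).
Proof.
move=> uniq_s defI; rewrite mem_inner => Qi.
by rewrite /leaf Qi degree_inner defI degree_set_seq.
Qed.

Hypothesis card_gt4 : 4 < #|G|.

Section Orientation.
Variables succ pred : G -> G.
Hypothesis cycG : cycle_structure succ pred.
Let E := cycle_eqE cycG card_gt4.
Let adjE := adj_cycle_succ cycG.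

Lemma degree_outer_cycle i : degree Q (U i) = (succ i \in O) + (pred i \in O) + (i \in I).
Proof. by rewrite degree_outer (degree_succ_pred cycG card_gt4). Qed.

Lemma outer_degree_le2 i : i \in O -> (succ i \in O) + (pred i \in O) + (i \in I) <= 2.
Proof. by rewrite -degree_outer_cycle mem_outer; exact: (path_degree_le2 pathQ). Qed.

Lemma leaf_outer i :
  i \in O -> leaf Q (U i) = ((succ i \in O) + (pred i \in O) + (i \in I) <= 1).
Proof. by rewrite /leaf degree_outer_cycle -mem_outer => ->. Qed.

Lemma card_inner_neq1 : #|I| != 1.
Proof.
apply/eqP => I1; pose A := [set u in Q | u.1].
have outerA : outer A = setT.
  rewrite (_ : outer A = O); last by apply/setP => i; rewrite !mem_outer inE andbT.
  by rewrite (@outer_eq_notin [::]) //; apply/setP => i; rewrite !inE.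
have [i0 _] : exists i0, i0 \in I by apply/card_gt0P; rewrite I1.
have [||[[] i]] := path_acyclic pathQ (A := A).
- by apply/subsetP => u; rewrite inE => /andP[].
- by apply/set0Pn; exists (U i0); have := in_setT i0; rewrite -outerA mem_outer.
- by rewrite /leaf degree_outer (degree_succ_pred cycG card_gt4) outerA !inE andbF.
- by rewrite /leaf inE andbF.
Qed.

(* The missing outer vertex has exactly its two cycle neighbours as inner indices, so that no
   vertex of [Q] is a leaf. *)
Lemma card_inner_neq2 : #|I| != 2.
Proof.
apply/eqP => I2; have /cards1P[m defM] : #|~: O| == 1 by rewrite -eqSS -card_inner I2.
have memO i : (i \in O) = (i != m) by rewrite -in_set1 -defM in_setC negbK.
have near_m i : i \in I -> [|| i == m, i == succ m | i == pred m].
  move=> Ii; have [//|i_m] := eqVneq i m.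
  have := outer_degree_le2 (_ : i \in O); rewrite Ii !memO i_m => /(_ isT).
  by rewrite (succ_eq_pred cycG) (pred_eq_succ cycG); do 2!case: (i == _).
have Im : m \notin I.
  apply/negP => /inner_degree_gt0; rewrite memO eqxx /= => /card_gt0P[i].
  rewrite inE => /andP[/near_m + /andP[m_i]].
  by rewrite (adj_cycle cycG) eq_sym (negPf m_i) /= => ->.
have I_uniq : uniq [:: succ m; pred m] by rewrite /= inE E.
have defI : I = [set:: [:: succ m; pred m]].
  apply/eqP; rewrite eqEcard I2 cardsE (card_uniqP I_uniq) andbT.
  apply/subsetP => i Ii; have := near_m i Ii; rewrite !inE.
  by case: eqVneq Ii Im => // -> ->.
have [|[[] i]] := path_acyclic pathQ (subxx Q); first by rewrite -card_gt0 (card_path pathQ).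
  rewrite /leaf -mem_outer degree_outer_cycle !memO defI !inE.
  rewrite (succ_eq_pred cycG) (pred_eq_succ cycG) => /andP[_].
  by case: (eqVneq i (succ m)) => [->|_]; [rewrite E | case: (i == pred m)].
rewrite /leaf -mem_inner degree_inner defI degree_set_seq // memO !inE /= => /andP[].
rewrite /complement_adj !adjE.
by case/orP=> /eqP->; rewrite ?(pred_eq_succ cycG) ?[_ == pred _]eq_sym ?(pred_eq_succ cycG) !E.
Qed.

Lemma run3_outer_first i :
  I = [set:: traject succ i 3] -> succ i \in O -> i \in O.
Proof.
move=> defI Oi1; apply: contraT => Oi.
have I_uniq : uniq (traject succ i 3) by rewrite /= !inE !E.
have memI x : (x \in I) = (x \in traject succ i 3) by rewrite defI inE.
have [Ii Ii1 Ii2] : [/\ i \in I, succ i \in I & succ (succ i) \in I].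
  by rewrite !memI !inE !E !orbT.
have leaf_i : leaf Q (V i).
  by rewrite (leaf_inner I_uniq defI) // (negPf Oi) /= /complement_adj !adjE !E.
have leaf_i1 : leaf Q (V (succ i)).
  by rewrite (leaf_inner I_uniq defI) // Oi1 /= /complement_adj !adjE !E.
have not_leaf x : leaf Q (U x) -> False.
  move=> leaf_x; apply: (path_no_third_leaf pathQ leaf_i leaf_i1 leaf_x).
  by rewrite /= !inE !xpair_eqE /= !E.
have Oi2 : succ (succ i) \in O.
  apply: contraT => Oi2; case: (not_leaf (succ i)).
  by rewrite leaf_outer // E (negPf Oi) (negPf Oi2); case: (_ \in I).
have Oi3 : succ (succ (succ i)) \notin O.
  by have := outer_degree_le2 Oi2; rewrite E Oi1 Ii2; case: (_ \in O).
have defO : O = [set x | x \notin [:: i; succ (succ (succ i))]].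
  apply: outer_eq_notin; last by rewrite defI cardsE (card_uniqP I_uniq).
    by rewrite /= inE E.
  by rewrite /= Oi Oi3.
have Oi4 : succ (succ (succ (succ i))) \in O by rewrite defO !inE !E.
have Ii4 : succ (succ (succ (succ i))) \notin I by rewrite memI !inE !E.
case: (not_leaf (succ (succ (succ (succ i))))).
by rewrite (leaf_outer Oi4) E (negPf Oi3) (negPf Ii4); case: (_ \in O).
Qed.

Lemma run2_far_outer_first i j :
  j \notin traject succ (pred i) 4 -> I = [set:: [:: i; succ i; j]] -> j \notin O -> i \in O.
Proof.
rewrite /= !inE !E => /norP[j_pi /norP[j_i /norP[j_i1 j_i2]]] defI Oj; apply: contraT => Oi.
have I_uniq : uniq [:: i; succ i; j].
  by rewrite /= !inE E ![_ == j]eq_sym (negPf j_i) (negPf j_i1).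
have defO : O = [set x | x \notin [:: i; j]].
  apply: outer_eq_notin; last by rewrite defI cardsE (card_uniqP I_uniq).
    by rewrite /= inE eq_sym j_i.
  by rewrite /= Oi Oj.
have leaf_pred x : x \notin O -> pred x \in O -> pred x \notin I -> leaf Q (U (pred x)).
  by move=> Ox Opx Ipx; rewrite leaf_outer // E (negPf Ox) (negPf Ipx); case: (_ \in O).
case: (path_no_third_leaf pathQ (x := V i) (y := U (pred i)) (z := U (pred j))).
- rewrite (leaf_inner I_uniq defI) ?(negPf Oi) ?defI ?inE ?eqxx //=.
  by rewrite /complement_adj !adjE !E /=; case: (_ && _).
- by apply: leaf_pred; rewrite // ?defI ?defO !inE !E /= eq_sym ?j_pi.
- apply: leaf_pred; rewrite // ?defI ?defO !inE !(pred_eq_succ cycG) !E ?negb_or.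
    by rewrite j_i1.
  by rewrite j_i1 j_i2.
- by rewrite /= !inE !xpair_eqE /= !E eq_sym j_i.
Qed.

Lemma run4_outer_second i : I = [set:: traject succ i 4] ->
  i \notin O -> succ (succ (succ i)) \notin O -> succ i \in O.
Proof.
move=> defI Oi Oi3; apply: contraT => Oi1.
have I_uniq : uniq (traject succ i 4) by rewrite /= !inE !E.
have memI x : (x \in I) = (x \in traject succ i 4) by rewrite defI inE.
have defO : O = [set x | x \notin [:: i; succ i; succ (succ (succ i))]].
  apply: outer_eq_notin; last by rewrite defI cardsE (card_uniqP I_uniq).
    by rewrite /= !inE !E.
  by rewrite /= Oi Oi1 Oi3.
have Ii1 : succ i \in I by rewrite memI !inE !E orbT.
have Oi2 : succ (succ i) \in O by rewrite defO !inE !E.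
have Oi4 : succ (succ (succ (succ i))) \in O by rewrite defO !inE !E.
have Ii4 : succ (succ (succ (succ i))) \notin I by rewrite memI !inE !E.
case: (path_no_third_leaf pathQ (x := V (succ i)) (y := U (succ (succ i)))
  (z := U (succ (succ (succ (succ i)))))).
- by rewrite (leaf_inner I_uniq defI) // (negPf Oi1) /= /complement_adj !adjE !E.
- by rewrite (leaf_outer Oi2) E (negPf Oi1) (negPf Oi3); case: (_ \in I).
- by rewrite (leaf_outer Oi4) E (negPf Oi3) (negPf Ii4); case: (_ \in O).
- by rewrite /= !inE !xpair_eqE /= !E.
Qed.

End Orientation.

Section Shapes.
Variables succ pred : G -> G.
Hypothesis cycG : cycle_structure succ pred.
Let cycG_rev := cycle_structure_rev cycG.
Let E := cycle_eqE cycG card_gt4.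
Let adjE := adj_cycle_succ cycG.

Lemma inner_neq_run3 i : I <> [set:: traject succ i 3].
Proof.
move=> defI; have memI x : (x \in I) = (x \in traject succ i 3) by rewrite defI inE.
have Ii1 : succ i \in I by rewrite memI !inE !E orbT.
have Oi1 : succ i \in O.
  apply: contraT => /negPf Oi1; have := inner_degree_gt0 Ii1.
  by rewrite Oi1 defI degree_set_seq /= ?inE ?E // /complement_adj !adjE !E.
have Oi : i \in O := run3_outer_first cycG defI Oi1.
have Oi2 : succ (succ i) \in O.
  apply: (run3_outer_first cycG_rev); last by rewrite E.
  by rewrite defI -(set_traject_pred cycG).
by have := outer_degree_le2 cycG Oi1; rewrite E Oi Oi2 Ii1.
Qed.

Lemma inner_neq_run2_far i j :
  j \notin traject succ (pred i) 4 -> I <> [set:: [:: i; succ i; j]].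
Proof.
move=> far_j defI; have := far_j.
rewrite /= !inE !E => /norP[j_pi /norP[j_i /norP[j_i1 j_i2]]].
have memI x : (x \in I) = (x \in [:: i; succ i; j]) by rewrite defI inE.
have [Ii Ii1 Ij] : [/\ i \in I, succ i \in I & j \in I] by rewrite !memI !inE !E !orbT.
have adj_ji : ~~ adj j i.
  by rewrite adjE negb_or j_i1 eq_sym (succ_eq_pred cycG) j_pi.
have adj_ji1 : ~~ adj j (succ i) by rewrite adjE E negb_or eq_sym j_i j_i2.
have I_uniq : uniq [:: i; succ i; j].
  by rewrite /= !inE E ![_ == j]eq_sym (negPf j_i) (negPf j_i1).
have Oj : j \notin O.
  apply/negP => Oj; have := inner_degree_le2 Ij.
  by rewrite Oj defI degree_set_seq //= /complement_adj adj_ji adj_ji1 j_i j_i1.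
have Oi : i \in O := run2_far_outer_first cycG far_j defI Oj.
have Oi1 : succ i \in O.
  apply: (run2_far_outer_first cycG_rev (j := j)) => //.
    by rewrite /= !inE !E (negPf j_pi) (negPf j_i) (negPf j_i1) (negPf j_i2).
  by rewrite E defI; apply/setP => x; rewrite !inE orbCA.
apply: (path_no_cycle pathQ (s := [:: V i; V j; V (succ i); U (succ i); U i])) => //.
- by rewrite /= !inE !xpair_eqE /= !E eq_sym (negPf j_i) (negPf j_i1).
- rewrite /= /prism_adj /= [adj i j]adj_sym (negPf adj_ji) adj_ji1 !adjE !E.
  by rewrite j_i1 eq_sym j_i.
- by apply/allP; rewrite /= -!mem_inner -!mem_outer Ii Ii1 Ij Oi Oi1.
Qed.

Lemma inner_neq_run4 i : I <> [set:: traject succ i 4].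
Proof.
move=> defI; have I_uniq : uniq (traject succ i 4) by rewrite /= !inE !E.
have memI x : (x \in I) = (x \in traject succ i 4) by rewrite defI inE.
have [Ii Ii1 Ii2 Ii3] : [/\ i \in I, succ i \in I, succ (succ i) \in I
    & succ (succ (succ i)) \in I] by rewrite !memI !inE !E !orbT.
have saturated_notin_outer x : x \in I -> 1 < @degree (complement G) I x -> x \notin O.
  by move=> /inner_degree_le2; case: (_ \in O) => //=; lia.
have Oi : i \notin O.
  apply: saturated_notin_outer => //.
  by rewrite defI degree_set_seq //= /complement_adj !adjE !E.
have Oi3 : succ (succ (succ i)) \notin O.
  apply: saturated_notin_outer => //.
  by rewrite defI degree_set_seq //= /complement_adj !adjE !E.
have Oi1 : succ i \in O := run4_outer_second cycG defI Oi Oi3.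
have Oi2 : succ (succ i) \in O.
  rewrite -[succ (succ i)](succK cycG).
  apply: (run4_outer_second cycG_rev); rewrite ?E //.
  by rewrite defI -(set_traject_pred cycG).
apply: (path_no_cycle pathQ (s := [:: V (succ i); V (succ (succ (succ i))); V i;
  V (succ (succ i)); U (succ (succ i)); U (succ i)])) => //.
- by rewrite /= !inE !xpair_eqE /= !E.
- by rewrite /= /prism_adj /= !adjE !E.
- by apply/allP; rewrite /= -!mem_inner -!mem_outer Ii Ii1 Ii2 Ii3 Oi1 Oi2.
Qed.

Lemma card_inner_neq3 i : i \in I -> succ i \in I -> #|I| != 3.
Proof.
move=> Ii Ii1; apply/eqP => /(set_seq_rcons (s := [:: i; succ i]))[||j].
- by rewrite /= inE E.
- by apply/allP; rewrite /= Ii Ii1.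
rewrite /= !inE => /norP[j_i j_i1] defI.
have [far_j|] := boolP (j \notin traject succ (pred i) 4).
  exact: (inner_neq_run2_far far_j defI).
rewrite negbK /= !inE !E (negPf j_i) (negPf j_i1) /= => /orP[]/eqP def_j.
  apply: (@inner_neq_run3 (pred i)); rewrite defI def_j /= E.
  by apply/setP => x; rewrite !inE orbA orbC.
by apply: (@inner_neq_run3 i); rewrite defI def_j.
Qed.

Lemma card_inner_neq4 i : i \in I -> succ i \in I -> pred i \in I -> #|I| != 4.
Proof.
move=> Ii Is Ip; apply/eqP => /(set_seq_rcons (s := [:: pred i; i; succ i]))[||j].
- by rewrite /= !inE !E.
- by apply/allP; rewrite /= Ii Is Ip.
rewrite /= !inE => /norP[j_p /norP[j_i j_s]] defI.
have [def_j|j_ss] := eqVneq j (succ (succ i)).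
  by apply: (@inner_neq_run4 (pred i)); rewrite defI def_j /= E.
have [def_j|j_pp] := eqVneq j (pred (pred i)).
  apply: (@inner_neq_run4 (pred (pred i))); rewrite defI def_j /= !E.
  by apply/setP => x; rewrite !inE [RHS]orbC !orbA.
have Ij : j \in I by rewrite defI !inE eqxx !orbT.
apply: (path_no_cycle pathQ (s := [:: V (succ i); V (pred i); V j])) => //.
- by rewrite /= !inE !xpair_eqE /= E ![_ == j]eq_sym j_p j_s.
- rewrite /= /prism_adj /= !adjE !E !(pred_eq_succ cycG) !E ![i == _]eq_sym.
  by rewrite !(succ_eq_pred cycG) j_p j_s !negb_or j_i j_pp j_ss.
- by apply/allP; rewrite /= -!mem_inner Is Ip Ij.
Qed.

End Shapes.
End PrismPath.

Lemma complementary_prism_path_free (G : sgraph) (succ pred : G -> G) :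
  cycle_structure succ pred -> 4 < #|G| ->
  ~ contains_induced (complementary_prism G) (path_graph #|G|.+1).
Proof.
move=> cycG card_gt4 [Q pathQ]; have cycG_rev := cycle_structure_rev cycG.
have [i Ii leaf_i] := exists_inner_leaf pathQ.
have := card_degree_complement Ii; rewrite (degree_succ_pred cycG card_gt4).
have := card_inner_neq1 pathQ card_gt4 cycG; have := card_inner_neq2 pathQ card_gt4 cycG.
have neq3 := card_inner_neq3 pathQ card_gt4; have neq4 := card_inner_neq4 pathQ card_gt4.
have [Is|_] := boolP (succ i \in inner Q); have [Ip|_] := boolP (pred i \in inner Q).
- by have := neq3 _ _ cycG _ Ii Is; have := neq4 _ _ cycG _ Ii Is Ip; lia.
- by have := neq3 _ _ cycG _ Ii Is; lia.
- by have := neq3 _ _ cycG_rev _ Ii Ip; lia.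
- lia.
Qed.

(** * Paths that appear when an edge is toggled *)

Definition nat_cycle_adj m : rel nat := fun i j =>
  [|| i.+1 == j, j.+1 == i, (i == 0) && (j == m.-1) | (j == 0) && (i == m.-1)].

(* The vertex at position [k] along the cycle, counted from a base vertex, has index [k]. *)
Definition toggled_path m (x y : bool * nat) (s : seq (bool * nat)) : Prop :=
  size s = m.+1 /\
  forall a b, a < b < size s ->
    let u := nth (true, 0) s a in let v := nth (true, 0) s b in
    [/\ u.2 < m, v.2 < m, u != v
      & prism_adj (nat_cycle_adj m) u v (+) ((u == x) && (v == y) || (u == y) && (v == x))
        = (a.+1 == b)].

Definition arc i j : seq (bool * nat) := [seq U k | k <- iota i (j - i)].

Lemma size_arc i j : size (arc i j) = j - i.
Proof. by rewrite size_map size_iota. Qed.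

Lemma nth_arc i j k : nth (true, 0) (arc i j) k = if k < j - i then U (i + k) else U 0.
Proof.
case: ltnP => [lt_k|le_k]; last by rewrite nth_default ?size_arc.
by rewrite (nth_map 0) ?size_iota // nth_iota.
Qed.

Lemma nth_rev_arc i j k :
  nth (true, 0) (rev (arc i j)) k = if k < j - i then U (j - k.+1) else U 0.
Proof.
case: ltnP => [lt_k|le_k]; last by rewrite nth_default ?size_rev ?size_arc.
rewrite nth_rev size_arc // nth_arc ifT; last lia.
by congr (_, _); lia.
Qed.

Lemma nth_consE (T : Type) (x0 x : T) s n : nth x0 (x :: s) n = if n < 1 then x else nth x0 s n.-1.
Proof. by case: n. Qed.

Ltac split_ltn :=
  repeat match goal with |- context [if (?a < ?b)%N then _ else _] =>
    case: (ltnP a b) => ?; try (exfalso; lia) end.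

Ltac decide_eqn :=
  repeat match goal with |- context [@eq_op _ ?a ?b] =>
    first [ rewrite (_ : (a == b) = false); [|lia]
          | rewrite (_ : (a == b) = true); [|lia]
          | case: (@eqP _ a b) => ? ]
  end.

Ltac solve_toggled_path :=
  match goal with |- toggled_path ?m _ _ ?s =>
    let size_s := fresh in
    have size_s : size s = m.+1 by [rewrite ?(size_cat, size_rev, size_arc) /=; lia];
    split=> // ? ?; rewrite size_s ltnS => ?; clear size_s
  end;
  rewrite ?(nth_cat, nth_arc, nth_rev_arc, nth_consE, nth_nil) ?(size_rev, size_arc);
  rewrite /prism_adj /nat_cycle_adj /=; split_ltn;
  (split; [move=> /=; lia | move=> /=; lia | |]);
  rewrite ?xpair_eqE /=; decide_eqn => //=; lia.

Lemma toggled_path_outer1 m : 4 < m ->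
  toggled_path m (U 0) (U 1) ([:: V 1] ++ arc 1 m ++ [:: U 0]).
Proof. by move=> m5; solve_toggled_path. Qed.

Lemma toggled_path_outer_far m j : 2 < j < m.-1 ->
  toggled_path m (U 0) (U j)
    ([:: V 1; V j.+1; V 2] ++ arc 2 j.+1 ++ [:: U 0] ++ rev (arc j.+2 m)).
Proof. by move=> j_far; solve_toggled_path. Qed.

Lemma toggled_path_spoke m : 4 < m ->
  toggled_path m (U 0) (V 0) ([:: V 0; V 2] ++ arc 2 m ++ [:: U 0]).
Proof. by move=> m5; solve_toggled_path. Qed.

Lemma toggled_path_cross_first m : 4 < m ->
  toggled_path m (U 0) (V 1) ([:: V 1; U 0] ++ rev (arc 2 m) ++ [:: V 2]).
Proof. by move=> m5; solve_toggled_path. Qed.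

Lemma toggled_path_cross_last m : 4 < m ->
  toggled_path m (U 0) (V m.-1) ([:: V m.-1] ++ arc 0 m.-1 ++ [:: V m.-2]).
Proof. by move=> m5; solve_toggled_path. Qed.

Lemma toggled_path_cross_far m j : 4 < m -> 1 < j < m.-1 ->
  toggled_path m (U 0) (V j)
    (arc 2 j ++ [:: V j.-1; V j.+1] ++ arc j.+1 m ++ [:: U 0; V j]).
Proof. by move=> m5 j_far; solve_toggled_path. Qed.

Lemma toggled_path_inner1 m : 4 < m ->
  toggled_path m (V 0) (V 1) (rev (arc 1 m) ++ [:: V 1; V 0]).
Proof. by move=> m5; solve_toggled_path. Qed.

Lemma toggled_path_inner2 m : 4 < m ->
  toggled_path m (V 0) (V 2) ([:: V 0; U 0] ++ rev (arc 2 m) ++ [:: V 2]).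
Proof. by move=> m5; solve_toggled_path. Qed.

Lemma toggled_path_inner_far m j : 2 < j < m.-2 ->
  toggled_path m (V 0) (V j)
    (arc 2 j.+1 ++ [:: V j; V 1; V j.+1; V 0; U 0] ++ rev (arc j.+3 m)).
Proof. by move=> j_far; solve_toggled_path. Qed.

Lemma toggled_path_cross m j : 4 < m -> j < m -> exists s, toggled_path m (U 0) (V j) s.
Proof.
move=> m5 lt_jm; have [->|j_gt0] := posnP j; first by eexists; apply: toggled_path_spoke.
have [->|j_neq1] := eqVneq j 1; first by eexists; apply: toggled_path_cross_first.
have [->|j_neq_last] := eqVneq j m.-1; first by eexists; apply: toggled_path_cross_last.
by eexists; apply: toggled_path_cross_far => //; lia.
Qed.

Lemma toggled_path_same_side m b j : 4 < m -> 0 < j < m ->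
  exists s, toggled_path m (b, 0) (b, j) s \/ toggled_path m (b, 0) (b, m - j) s.
Proof.
move=> m5 j_bnd; case: b.
- have [->|j_neq1] := eqVneq j 1; first by eexists; left; apply: toggled_path_outer1.
  have [->|j_neq_last] := eqVneq j m.-1.
    by eexists; right; rewrite (_ : m - m.-1 = 1); [apply: toggled_path_outer1 | lia].
  have [->|j_neq2] := eqVneq j 2; last by eexists; left; apply: toggled_path_outer_far; lia.
  by eexists; right; apply: toggled_path_outer_far; lia.
- have [->|j_neq1] := eqVneq j 1; first by eexists; left; apply: toggled_path_inner1.
  have [->|j_neq2] := eqVneq j 2; first by eexists; left; apply: toggled_path_inner2.
  have [->|j_neq_last] := eqVneq j m.-1.
    by eexists; right; rewrite (_ : m - m.-1 = 1); [apply: toggled_path_inner1 | lia].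
  have [->|j_neq_last2] := eqVneq j m.-2.
    by eexists; right; rewrite (_ : m - m.-2 = 2); [apply: toggled_path_inner2 | lia].
  by eexists; left; apply: toggled_path_inner_far; lia.
Qed.

Section ToggledCyclePrism.
Variables (G : sgraph) (succ pred : G -> G).
Hypothesis cycG : cycle_structure succ pred.

Lemma adj_iter_succ i a b : a < #|G| -> b < #|G| ->
  adj (iter a succ i) (iter b succ i) = nat_cycle_adj #|G| a b.
Proof.
move=> lt_a lt_b; have cardS c : c.+1 = #|G| -> iter c.+1 succ i = iter 0 succ i.
  by move->; apply: iter_succ_card cycG i.
rewrite (adj_cycle_succ cycG) -!iterS /nat_cycle_adj.
have [[eq_a|lt_aS] [eq_b|lt_bS]] :
  (a.+1 = #|G| \/ a.+1 < #|G|) /\ (b.+1 = #|G| \/ b.+1 < #|G|) by lia.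
- by rewrite !cardS // !(eq_iter_succ cycG); lia.
- by rewrite (cardS a) // !(eq_iter_succ cycG); lia.
- by rewrite (cardS b) // !(eq_iter_succ cycG); lia.
- by rewrite !(eq_iter_succ cycG); lia.
Qed.

Lemma contains_toggled_path (i : G) a b j s : j < #|G| ->
  toggled_path #|G| (a, 0) (b, j) s ->
  contains_induced (@toggle_edge (complementary_prism G) (a, i) (b, iter j succ i))
    (path_graph #|G|.+1).
Proof.
move=> lt_j [size_s sP]; apply/contains_inducedP; have card_gt0 : 0 < #|G| by apply: leq_trans lt_j.
pose f (u : bool * nat) : complementary_prism G := (u.1, iter u.2 succ i).
have eq_f u v : u.2 < #|G| -> v.2 < #|G| -> (f u == f v) = (u == v).
  by move=> lt_u lt_v; rewrite !xpair_eqE (eq_iter_succ cycG).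
have adj_f u v : u.2 < #|G| -> v.2 < #|G| -> adj (f u) (f v) = prism_adj (nat_cycle_adj #|G|) u v.
  by move=> lt_u lt_v; rewrite /= /prism_adj /= (eq_iter_succ cycG) // adj_iter_succ.
exists (fun t : 'I_ #|G|.+1 => f (nth (true, 0) s t)).
apply: path_induced_embedding => t t' lt_t.
have [|lt_u lt_v ne_uv <-] := sP t t'; first by rewrite lt_t size_s ltn_ord.
rewrite eq_f // ne_uv; split=> //; rewrite /= /toggle_adj eq_f // ne_uv adj_f // eq_set2E.
by rewrite -[(a, i)]/(f (a, 0)) -[(b, _)]/(f (b, j)) !eq_f.
Qed.

Hypothesis card_gt4 : 4 < #|G|.

Lemma contains_toggle_cross i j :
  contains_induced (@toggle_edge (complementary_prism G) (U i) (V j)) (path_graph #|G|.+1).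
Proof.
have conn := succ_connected cycG i j; have := findex_max conn; rewrite (order_succ cycG) => lt_d.
have [s s_path] := toggled_path_cross card_gt4 lt_d.
by rewrite -(iter_findex conn); apply: contains_toggled_path s_path.
Qed.

Lemma contains_toggle_same_side b i j : i != j ->
  contains_induced (@toggle_edge (complementary_prism G) (b, i) (b, j)) (path_graph #|G|.+1).
Proof.
move=> ne_ij; have conn := succ_connected cycG i j.
have := findex_max conn; rewrite (order_succ cycG) => lt_d.
have d_gt0 : 0 < findex succ i j by rewrite lt0n findex_eq0.
have [|s [s_path|s_path]] := @toggled_path_same_side #|G| b (findex succ i j) card_gt4.
- by rewrite d_gt0.
- by rewrite -(iter_findex conn); apply: contains_toggled_path s_path.
have iter_j : iter (#|G| - findex succ i j) succ j = i.
  by rewrite -[X in iter _ _ X](iter_findex conn) (iter_succ_subK cycG) // ltnW.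
apply: contains_toggle_edgeC; have := contains_toggled_path j _ s_path; rewrite iter_j; apply; lia.
Qed.

Lemma complementary_prism_induced_saturated :
  induced_saturated (path_graph #|G|.+1) (complementary_prism G).
Proof.
apply: toggle_induced_saturated; first exact: (complementary_prism_path_free cycG card_gt4).
move=> [a i] [b j]; case: (eqVneq a b) => [<-|].
  by rewrite xpair_eqE eqxx; apply: contains_toggle_same_side.
case: a b => [] [] // _ _; first exact: contains_toggle_cross.
exact: contains_toggle_edgeC (contains_toggle_cross j i).
Qed.

End ToggledCyclePrism.

(** * Cycle graphs and complete graphs *)

Section CycleGraph.
Variable m : nat.

Definition cycle_graph_adj : rel 'I_m :=
  fun i j => (i != j) && ((j == ordS i) || (i == ordS j)).

Fact cycle_graph_adj_sym : symmetric cycle_graph_adj.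
Proof. by move=> i j; rewrite /cycle_graph_adj eq_sym orbC. Qed.

Fact cycle_graph_adj_irr : irreflexive cycle_graph_adj.
Proof. by move=> i; rewrite /cycle_graph_adj eqxx. Qed.

Definition cycle_graph : sgraph := SGraph cycle_graph_adj_sym cycle_graph_adj_irr.

Lemma val_iter_ordS k (i : 'I_m) : iter k (@ordS m) i = (i + k) %% m :> nat.
Proof.
elim: k => [|k IHk]; first by rewrite addn0 modn_small.
by rewrite iterS /= IHk -addn1 modnDml addn1 addnS.
Qed.

Lemma cycle_graph_structure : 1 < m -> @cycle_structure cycle_graph (@ordS m) (@ord_pred m).
Proof.
move=> m_gt1; have ordS_neq (i : 'I_m) : i != ordS i.
  have := ltn_ord i; rewrite -val_eqE /=; case: (ltnP i.+1 m) => [/modn_small->|]; first by lia.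
  by move=> le_m lt_i; rewrite (_ : i.+1 = m) ?modnn; lia.
split=> [i|i|i j|i j]; rewrite ?ordSK ?ord_predK //.
  rewrite /= /cycle_graph_adj -[i == ordS j](can2_eq (@ord_predK m) (@ordSK m)).
  rewrite [ord_pred i == j]eq_sym.
  rewrite andb_idl // => /orP[]/eqP->; first exact: ordS_neq.
  by rewrite -{1}[i]ord_predK eq_sym.
have -> : j = iter (j + (m - i)) (@ordS m) i; last exact: fconnect_iter.
apply: val_inj; rewrite /= val_iter_ordS addnCA subnKC ?modnDr ?modn_small //.
exact: ltnW.
Qed.

End CycleGraph.

Section CompleteGraph.
Variable T : finType.

Definition complete_adj : rel T := fun x y => x != y.

Fact complete_adj_sym : symmetric complete_adj.
Proof. by move=> x y; rewrite /complete_adj eq_sym. Qed.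

Fact complete_adj_irr : irreflexive complete_adj.
Proof. by move=> x; rewrite /complete_adj eqxx. Qed.

Definition complete_graph : sgraph := SGraph complete_adj_sym complete_adj_irr.

Lemma complete_graph_induced_saturated :
  2 < #|T| -> induced_saturated (path_graph 3) complete_graph.
Proof.
move=> card_gt2; apply: toggle_induced_saturated => [|x y ne_xy].
  move/contains_inducedP=> [p [inj_p adj_p]].
  by have := adj_p ord0 ord_max; rewrite /= /complete_adj (inj_eq inj_p).
have /subsetPn[z _] : ~~ ([set: T] \subset [set x; y]).
  by apply: contraL card_gt2 => /subset_leq_card; rewrite cardsT cards2 ne_xy -leqNgt.
rewrite !inE => /norP[z_x z_y]; apply/contains_inducedP.
exists (fun i : 'I_3 => nth x [:: x; z; y] i); apply: path_induced_embedding.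
by move=> [[|[|[|//]]] ?] [[|[|[|//]]] ?] //= _; rewrite /toggle_adj /= /complete_adj eq_set2E
  ?[x == z]eq_sym ?[y == z]eq_sym ?eqxx ?(negPf z_x) ?(negPf z_y) ?ne_xy ?andbF.
Qed.

End CompleteGraph.

Theorem theorem1p2 (n : nat) (hn : 0 < n) :
  exists G : sgraph, 1 < #|G| /\ induced_saturated (path_graph (3 * n)) G.
Proof.
have [->|n_neq1] := eqVneq n 1.
  exists (complete_graph 'I_3); rewrite card_ord; split=> //.
  by apply: complete_graph_induced_saturated; rewrite card_ord.
have cycC := @cycle_graph_structure (3 * n).-1.
exists (complementary_prism (cycle_graph (3 * n).-1)); split.
  by rewrite card_prod card_bool card_ord; lia.
have {1}-> : 3 * n = #|cycle_graph (3 * n).-1|.+1 by rewrite card_ord; lia.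
by apply: (complementary_prism_induced_saturated (cycC _)); rewrite ?card_ord; lia.
Qed.
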